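(* Let $\mathcal K$ be a complete idempotent reflexive semiring and let $A\in\mathcal K^{n\times p}$. Then the row space $\mathcal R(A)=\{yA\mid y\in\mathcal K^{1\times n}\}$ and the column space $\mathcal C(A)=\{Ax\mid x\in\mathcal K^{p\times 1}\}$ are anti-isomorphic lattices.
   Context: A semiring $(\mathcal K,\oplus,\otimes,\varepsilon,e)$ is idempotent if $a\oplus a=a$ for all $a$; its natural order is $a\le b\iff a\oplus b=b$. It is complete if every subset $U$ has a least upper bound $\bigvee U$ for the natural order and all left and right multiplications $f$ satisfy $f(\bigvee U)=\bigvee f(U)$ for every subset $U$ (including $U=\varnothing$). For $\lambda,\varphi\in\mathcal K$: $\lambda\backslash\varphi=\max\{\mu\in\mathcal K\mid\lambda\mu\le\varphi\}$ and $\varphi/\lambda=\max\{\mu\in\mathcal K\mid\mu\lambda\le\varphi\}$. $\mathcal K$ is reflexive, with distinguished element $\varphi\in\mathcal K$, if $\varphi/(\lambda\backslash\varphi)=\lambda$ (left reflexive) and $(\varphi/\lambda)\backslash\varphi=\lambda$ (right reflexive) for all $\lambda\in\mathcal K$. Matrix products are taken in the semiring $\mathcal K$ (sums are $\oplus$, products are $\otimes$). $\mathcal R(A)\subset\mathcal K^{1\times p}$ and $\mathcal C(A)\subset\mathcal K^{n\times1}$ are ordered by the entrywise natural order; they are (complete) lattices for these orders. Two lattices are anti-isomorphic if there is a bijection between them that exchanges suprema and infima (equivalently, an order-reversing bijection with order-reversing inverse). *)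

(* Defs.v *)
From HB Require Import structures.
From mathcomp Require Import all_boot all_order all_algebra.
From mathcomp Require Import boolp classical_sets.

Set Implicit Arguments.
Unset Strict Implicit.
Unset Printing Implicit Defensive.

Import Order.TTheory GRing.Theory Num.Theory.
Local Open Scope classical_set_scope.
Local Open Scope ring_scope.

(* Semirings are MathComp's [pzSemiRingType]: multiplication need not commute,
   0 is absorbing, and 0 = 1 is not excluded. *)
HB.mixin Record PzSemiRing_isIdem R of GRing.PzSemiRing R := {
  addrr : forall a : R, a + a = a
}.

#[short(type="idemSemiRingType")]
HB.structure Definition IdemSemiRing :=
  {R of GRing.PzSemiRing R & PzSemiRing_isIdem R}.

Section NaturalOrder.
Variable K : idemSemiRingType.
Implicit Types a b c : K.

Definition le_nat_order a b : bool := a + b == b.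

Lemma le_nat_order_refl : reflexive le_nat_order.
Proof. by move=> a; rewrite /le_nat_order addrr. Qed.

Lemma le_nat_order_anti : antisymmetric le_nat_order.
Proof. by move=> a b /andP[/eqP ab /eqP]; rewrite addrC ab. Qed.

Lemma le_nat_order_trans : transitive le_nat_order.
Proof.
move=> b a c /eqP ab /eqP bc.
by rewrite /le_nat_order -{1}bc addrA ab bc.
Qed.

HB.instance Definition _ := Order.Le_isPOrder.Build ring_display
  (IdemSemiRing.sort K)
  le_nat_order_refl le_nat_order_anti le_nat_order_trans.

Lemma le_naturalE a b : (a <= b) = (a + b == b).
Proof. by []. Qed.

End NaturalOrder.

Section MatrixOrder.
Variables (d : Order.disp_t) (T : porderType d) (m n : nat).
Implicit Types A B C : 'M[T]_(m, n).

Definition le_mx A B := [forall i, forall j, (A i j <= B i j)%O].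

Lemma le_mxP A B : reflect (forall i j, (A i j <= B i j)%O) (le_mx A B).
Proof. by apply: (iffP forallP) => AB i; apply/forallP. Qed.

Lemma le_mx_refl : reflexive le_mx.
Proof. by move=> A; apply/le_mxP. Qed.

Lemma le_mx_anti : antisymmetric le_mx.
Proof.
move=> A B /andP[/le_mxP AB /le_mxP BA]; apply/matrixP => i j.
by apply: le_anti; rewrite AB BA.
Qed.

Lemma le_mx_trans : transitive le_mx.
Proof.
move=> B A C /le_mxP AB /le_mxP BC; apply/le_mxP => i j.
exact: le_trans (AB i j) (BC i j).
Qed.

HB.instance Definition _ :=
  Order.Le_isPOrder.Build d 'M[T]_(m, n) le_mx_refl le_mx_anti le_mx_trans.

End MatrixOrder.

HB.instance Definition _ (T : choiceType) (A : set T) :=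
  SubChoice.copy (set_type A) {x : T | x \in A}.

(* A set, used as a type, carries the restriction of the ambient order; in
   particular suprema in a subset of matrices are taken within this subset. *)
HB.instance Definition _ d (T : porderType d) (A : set T) :=
  [SubChoice_isSubPOrder of set_type A by <: with d].

Section Semiring.
Variable K : idemSemiRingType.
Implicit Types (a s phi : K) (U : set K).

Definition complete_semiring : Prop :=
  (forall U, supremums U !=set0) /\
  (forall U s a, supremums U s ->
     supremums [set a * x | x in U] (a * s) /\
     supremums [set x * a | x in U] (s * a)).

(* The greatest element of [U]; it is 0 when there is none. *)
Definition greatest U : K := xget 0 (U `&` ubound U).

(* [lres a phi] is a \ phi and [rres phi a] is phi / a. *)
Definition lres a phi : K := greatest [set x | a * x <= phi].
Definition rres phi a : K := greatest [set x | x * a <= phi].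

Definition reflexive_semiring phi : Prop :=
  (forall a, rres phi (lres a phi) = a) /\
  (forall a, lres (rres phi a) phi = a).

Section Spaces.
Variables (n p : nat) (A : 'M[K]_(n, p)).

Definition row_space : set 'rV[K]_p := [set y *m A | y in [set: 'rV[K]_n]].
Definition col_space : set 'cV[K]_n := [set A *m x | x in [set: 'cV[K]_p]].

End Spaces.
End Semiring.

Definition complete_lattice d (L : porderType d) : Prop :=
  forall U : set L, supremums U !=set0 /\ infimums U !=set0.

(* [supremums U] is the set of least upper bounds of [U], a singleton here, so
   the equalities say f (sup U) = inf (f U) and f (inf U) = sup (f U). *)
Definition anti_isomorphic d d' (L : porderType d) (M : porderType d') : Prop :=
  exists f : L -> M, bijective f /\
    forall U : set L,
      f @` supremums U = infimums (f @` U) /\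
      f @` infimums U = supremums (f @` U).

(* Main.v *)
Require Import Defs.
From mathcomp Require Import all_boot all_order all_algebra.
From mathcomp Require Import boolp classical_sets.

(** Left and right division of [phi] by the entries of a vector, [r |-> r \ phi]
   and [c |-> phi / c], are order-reversing and, by reflexivity, mutually inverse
   maps between rows and columns, and [r c <= phi] iff [c <= r \ phi] iff
   [r <= phi / c].  Hence [y A <= r] iff [y A (r \ phi) <= phi] iff
   [y <= phi / (A (r \ phi))], so that [phi / (A (r \ phi))] is the greatest
   solution [y] of [y A <= r], and [(phi / (A (r \ phi))) A = r] when [r] is in
   the row space.  Together with the dual statement, this shows that
   [r |-> A (r \ phi)] and [c |-> (phi / c) A] are inverse anti-isomorphisms.
   The supremum of [U] in the row space is [y A], with [y] the greatest solution
   of [y A <= s] and [s] the entrywise supremum of [U]. *)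

Set Implicit Arguments.
Unset Strict Implicit.
Unset Printing Implicit Defensive.

Import Order.TTheory GRing.Theory.
Local Open Scope classical_set_scope.
Local Open Scope ring_scope.

Section Lattices.
Context {d d' : Order.disp_t} {L : porderType d} {M : porderType d'}.

(** An infimum of [U] is a supremum of its set of lower bounds. *)
Lemma supremums_complete_lattice :
  (forall U : set L, supremums U !=set0) -> complete_lattice L.
Proof.
move=> supL U; split; first exact: supL.
have [s [ubs lbs]] := supL (lbound U).
exists s; split => [x Ux|x lbx]; last exact: ubs.
by apply: lbs => y; apply.
Qed.

(** Every subset of [M] is the image under [f] of a subset of [L], whose infimum and supremum [f]
    sends to the required supremum and infimum. *)
Lemma anti_isomorphic_complete :
  anti_isomorphic L M -> complete_lattice L -> complete_lattice M.
Proof.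
move=> [f [[g fK gK] fsup]] cL U.
have -> : U = f @` (g @` U).
  by rewrite image_comp (_ : f \o g = id) ?image_id //; exact: funext.
have [<- <-] := fsup (g @` U); have [[s sU] [i iU]] := cL (g @` U).
by split; [exists (f i), i | exists (f s), s].
Qed.

(** A supremum is an upper bound that is also a lower bound of the upper bounds; [f] exchanges the
    two kinds of bounds, and surjectivity makes it carry the whole set of bounds onto the opposite
    one. *)
Lemma anti_mono_anti_isomorphic (f : L -> M) (g : M -> L) :
    cancel f g -> cancel g f -> {mono f : x y /~ (x <= y)%O} ->
  anti_isomorphic L M.
Proof.
move=> fK gK f_anti; exists f; split=> [|U]; first by exists g.
have f_ub (V : set L) x : ubound V x <-> lbound (f @` V) (f x).
  split=> [ub _ [y Vy <-]|lb y Vy]; first by rewrite f_anti; apply: ub.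
  by rewrite -f_anti; apply: lb; exists y.
have f_lb (V : set L) x : lbound V x <-> ubound (f @` V) (f x).
  split=> [lb _ [y Vy <-]|ub y Vy]; first by rewrite f_anti; apply: lb.
  by rewrite -f_anti; apply: ub; exists y.
have f_ubE (V : set L) : f @` ubound V = lbound (f @` V).
  apply/seteqP; split=> [_ [x /f_ub ? <-] //|z lbz].
  by exists (g z); [apply/f_ub; rewrite gK | exact: gK].
have f_lbE (V : set L) : f @` lbound V = ubound (f @` V).
  apply/seteqP; split=> [_ [x /f_lb ? <-] //|z ubz].
  by exists (g z); [apply/f_lb; rewrite gK | exact: gK].
split; apply/seteqP; split.
- by move=> _ [x [/f_ub ? /f_lb lbx] <-]; split=> //; rewrite -f_ubE.
- move=> z [lbz ubz]; exists (g z); last exact: gK.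
  by split; [apply/f_ub | apply/f_lb; rewrite f_ubE]; rewrite gK.
- by move=> _ [x [/f_lb ? /f_ub ubx] <-]; split=> //; rewrite -f_lbE.
- move=> z [ubz lbz]; exists (g z); last exact: gK.
  by split; [apply/f_lb | apply/f_ub; rewrite f_lbE]; rewrite gK.
Qed.

End Lattices.

Section IdempotentSemiring.
Variable K : idemSemiRingType.
Implicit Types a b c : K.

Lemma idem_le_add a b c : (a + b <= c) = (a <= c) && (b <= c).
Proof.
rewrite !le_naturalE; apply/eqP/andP => [<-|[/eqP ac /eqP bc]].
  by split; apply/eqP; [rewrite !addrA addrr | rewrite (addrC a) !addrA addrr].
by rewrite -addrA bc.
Qed.

Lemma idem_ge0 a : (0 : K) <= a.
Proof. by rewrite le_naturalE add0r. Qed.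

(** Addition is the binary join and 0 the empty join, so a matrix product can be bounded term by
    term. *)
Lemma idem_le_sum (I : finType) (F : I -> K) c :
  (\sum_i F i <= c) = [forall i, F i <= c].
Proof.
apply/idP/forallP => [Fc i|Fc].
  by move: Fc; rewrite (bigD1 i) //= idem_le_add => /andP[].
by elim/big_ind: _ => [|a b ac bc|i _]; rewrite ?idem_ge0 ?idem_le_add ?ac.
Qed.

Lemma idem_ler_sum (I : finType) (F G : I -> K) :
  (forall i, F i <= G i) -> \sum_i F i <= \sum_i G i.
Proof.
move=> FG; rewrite le_naturalE -big_split /=; apply/eqP/eq_bigr => i _.
by apply/eqP; rewrite -le_naturalE.
Qed.

Lemma idem_mul_homo_l a b c : b <= c -> a * b <= a * c.
Proof. by rewrite !le_naturalE -mulrDr => /eqP ->. Qed.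

Lemma idem_mul_homo_r a b c : b <= c -> b * a <= c * a.
Proof. by rewrite !le_naturalE -mulrDl => /eqP ->. Qed.

Lemma idem_mulmx_homo_r m n p (A : 'M[K]_(n, p)) :
  {homo (fun y : 'M[K]_(m, n) => y *m A) : x y / (x <= y)%O}.
Proof.
move=> x y /le_mxP xy; apply/le_mxP => i j; rewrite !mxE.
by apply: idem_ler_sum => k; exact: idem_mul_homo_r.
Qed.

Lemma idem_mulmx_homo_l m n p (A : 'M[K]_(m, n)) :
  {homo (fun x : 'M[K]_(n, p) => A *m x) : x y / (x <= y)%O}.
Proof.
move=> x y /le_mxP xy; apply/le_mxP => i j; rewrite !mxE.
by apply: idem_ler_sum => k; exact: idem_mul_homo_l.
Qed.

End IdempotentSemiring.

Section Residuation.
Variables (K : idemSemiRingType) (phi : K).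
Hypothesis K_complete : complete_semiring K.
Implicit Types a b : K.

(** The witness [m] rules out the default value 0 of [greatest]. *)
Lemma greatestP (U : set K) m : U m -> ubound U m ->
  U (greatest U) /\ ubound U (greatest U).
Proof.
by move=> Um ubm; rewrite /greatest; case: xgetP => [_ -> []|/(_ m)[]].
Qed.

(** By completeness, multiplication by [a] preserves the supremum [s] of the solutions, so [s] is
    itself a solution and the maximum exists. *)
Lemma lresP a b : (a * b <= phi) = (b <= lres a phi).
Proof.
have [s supU] := K_complete.1 [set x | a * x <= phi].
have [[_ lub] _] := K_complete.2 _ _ a supU.
have [||le_phi ub] := @greatestP [set x | a * x <= phi] s.
- by apply: lub => _ [x xU <-].
- exact: supU.1.
apply/idP/idP => [/ub //|b_le].
exact: le_trans (idem_mul_homo_l _ b_le) le_phi.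
Qed.

Lemma rresP a b : (a * b <= phi) = (a <= rres phi b).
Proof.
have [s supU] := K_complete.1 [set x | x * b <= phi].
have [_ [_ lub]] := K_complete.2 _ _ b supU.
have [||le_phi ub] := @greatestP [set x | x * b <= phi] s.
- by apply: lub => _ [x xU <-].
- exact: supU.1.
apply/idP/idP => [/ub //|a_le].
exact: le_trans (idem_mul_homo_r _ a_le) le_phi.
Qed.

Definition lres_row q (r : 'rV[K]_q) : 'cV[K]_q := \col_j lres (r 0 j) phi.
Definition rres_col q (c : 'cV[K]_q) : 'rV[K]_q := \row_j rres phi (c j 0).

Lemma lres_rowP q (r : 'rV[K]_q) (c : 'cV[K]_q) :
  ((r *m c) 0 0 <= phi) = (c <= lres_row r)%O.
Proof.
rewrite mxE idem_le_sum; apply/forallP/le_mxP => [rc i j|rc i].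
  by rewrite ord1 mxE -lresP.
by have := rc i 0; rewrite mxE -lresP.
Qed.

Lemma rres_colP q (r : 'rV[K]_q) (c : 'cV[K]_q) :
  ((r *m c) 0 0 <= phi) = (r <= rres_col c)%O.
Proof.
rewrite mxE idem_le_sum; apply/forallP/le_mxP => [rc i j|rc i].
  by rewrite ord1 mxE -rresP.
by have := rc 0 i; rewrite mxE -rresP.
Qed.

Lemma lres_row_anti q : {homo @lres_row q : r s /~ (r <= s)%O}.
Proof.
move=> r s sr; rewrite -lres_rowP rres_colP; apply: le_trans sr _.
by rewrite -rres_colP lres_rowP.
Qed.

Lemma rres_col_anti q : {homo @rres_col q : r s /~ (r <= s)%O}.
Proof.
move=> r s sr; rewrite -rres_colP lres_rowP; apply: le_trans sr _.
by rewrite -lres_rowP rres_colP.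
Qed.

Hypothesis K_reflexive : reflexive_semiring phi.

Lemma lres_rowK q : cancel (@lres_row q) (@rres_col q).
Proof. by move=> r; apply/rowP => j; rewrite !mxE K_reflexive.1. Qed.

Lemma rres_colK q : cancel (@rres_col q) (@lres_row q).
Proof. by move=> c; apply/colP => j; rewrite !mxE K_reflexive.2. Qed.

Section Matrix.
Variables (n p : nat) (A : 'M[K]_(n, p)).

Definition row_to_col (r : 'rV[K]_p) : 'cV[K]_n := A *m lres_row r.
Definition col_to_row (c : 'cV[K]_n) : 'rV[K]_p := rres_col c *m A.

(** Associativity moves [A] from [y] to [lres_row r]; reflexivity turns [rres_col (lres_row r)] back
    into [r]. *)
Lemma row_mulmx_residual (y : 'rV[K]_n) (r : 'rV[K]_p) :
  (y *m A <= r)%O = (y <= rres_col (row_to_col r))%O.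
Proof. by rewrite -rres_colP mulmxA rres_colP lres_rowK. Qed.

Lemma col_mulmx_residual (x : 'cV[K]_p) (c : 'cV[K]_n) :
  (A *m x <= c)%O = (x <= lres_row (col_to_row c))%O.
Proof. by rewrite -lres_rowP -mulmxA lres_rowP rres_colK. Qed.

Lemma col_to_row_row_to_col_le (r : 'rV[K]_p) :
  (col_to_row (row_to_col r) <= r)%O.
Proof. by rewrite row_mulmx_residual. Qed.

Lemma row_to_colK : {in row_space A, cancel row_to_col col_to_row}.
Proof.
move=> _ /set_mem[y _ <-]; apply: le_anti; rewrite col_to_row_row_to_col_le /=.
(* [y] solves its own inequality, so it lies below the greatest solution. *)
by apply: idem_mulmx_homo_r; rewrite -row_mulmx_residual.
Qed.

Lemma col_to_rowK : {in col_space A, cancel col_to_row row_to_col}.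
Proof.
move=> _ /set_mem[x _ <-]; apply: le_anti; rewrite col_mulmx_residual lexx /=.
by apply: idem_mulmx_homo_l; rewrite -col_mulmx_residual.
Qed.

Lemma row_to_col_anti : {homo row_to_col : r s /~ (r <= s)%O}.
Proof. by move=> r s /lres_row_anti/(idem_mulmx_homo_l A). Qed.

Lemma col_to_row_anti : {homo col_to_row : c e /~ (c <= e)%O}.
Proof. by move=> c e /rres_col_anti/(idem_mulmx_homo_r A). Qed.

Lemma row_to_col_in r : row_to_col r \in col_space A.
Proof. by apply/mem_set; exists (lres_row r). Qed.

Lemma col_to_row_in c : col_to_row c \in row_space A.
Proof. by apply/mem_set; exists (rres_col c). Qed.

Lemma row_col_anti_isomorphic :
  anti_isomorphic (set_type (row_space A)) (set_type (col_space A)).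
Proof.
pose f (r : row_space A) : col_space A := SigSub (row_to_col_in (val r)).
pose g (c : col_space A) : row_space A := SigSub (col_to_row_in (val c)).
have fK : cancel f g by move=> r; apply/val_inj/row_to_colK/valP.
have gK : cancel g f by move=> c; apply/val_inj/col_to_rowK/valP.
apply: (anti_mono_anti_isomorphic fK gK) => r s.
apply/idP/idP => [|sr]; last exact: row_to_col_anti.
(* The order is reflected because the inverse map also reverses it. *)
by move/col_to_row_anti; rewrite (row_to_colK (valP r)) (row_to_colK (valP s)).
Qed.

Lemma row_space_complete : complete_lattice (set_type (row_space A)).
Proof.
apply: supremums_complete_lattice => U.
(* The entrywise supremum [s] need not lie in the row space. *)
have [s sP] : exists s : 'rV[K]_p,
    forall j, supremums [set (val u : 'rV[K]_p) 0 j | u in U] (s 0 j).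
  have [s sP] := choice (fun j : 'I_p =>
    K_complete.1 [set (val u : 'rV[K]_p) 0 j | u in U]).
  by exists (\row_j s j) => j; rewrite mxE.
(* The composite [col_to_row \o row_to_col] is monotone, decreases its argument and fixes the row
   space, so it sends [s] to the greatest element of the row space below [s]. *)
exists (SigSub (col_to_row_in (row_to_col s))); split=> [u Uu|v ubv].
  have us : (val u <= s)%O.
    by apply/le_mxP => i j; rewrite ord1; apply: (sP j).1; exists u.
  change (val u <= col_to_row (row_to_col s))%O.
  rewrite -[leLHS](row_to_colK (valP u)).
  exact: col_to_row_anti (row_to_col_anti us).
change (col_to_row (row_to_col s) <= val v)%O.
apply: le_trans (col_to_row_row_to_col_le s) _; apply/le_mxP => i j.
rewrite ord1; apply: (sP j).2 => _ [u Uu <-].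
by have /le_mxP := ubv u Uu; apply.
Qed.

End Matrix.
End Residuation.

Theorem theorem42 (K : idemSemiRingType) (phi : K) (n p : nat)
    (A : 'M[K]_(n, p)) (K_complete : complete_semiring K)
    (K_reflexive : reflexive_semiring phi) :
  [/\ complete_lattice (set_type (row_space A)),
      complete_lattice (set_type (col_space A)) &
      anti_isomorphic (set_type (row_space A)) (set_type (col_space A))].
Proof.
have row_complete := row_space_complete K_complete K_reflexive (A := A).
have row_col := row_col_anti_isomorphic K_complete K_reflexive A.
by split=> //; exact: anti_isomorphic_complete row_col row_complete.
Qed.
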